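(* Let $\mathcal{S}=\mathcal{S}_1\cup\mathcal{S}_2$ be a partition of $\mathcal{S}$ into disjoint (possibly empty) sets, and let $\mathcal{P}=\mathcal{P}_1\times\mathcal{P}_2\subset\Delta(\mathcal{S})^{\mathcal{S}\times\mathcal{A}}$ where $$\mathcal{P}_1=\prod_{s\in\mathcal{S}_1}\mathcal{P}_s,\qquad \mathcal{P}_s\subset\Delta(\mathcal{S})^{\mathcal{A}},$$ $$\mathcal{P}_2=\Big\{\Big(\sum_{i=1}^ru^i_{sa}w^i\Big)_{s\in\mathcal{S}_2,a\in\mathcal{A}} : (w^1,\dots,w^r)\in\mathcal{W}^1\times\dots\times\mathcal{W}^r\Big\}$$ for some integer $r$, fixed coefficients $u_{sa}=(u^i_{sa})_{i\in[r]}\in\Delta([r])$ and sets $\mathcal{W}^i\subset\Delta(\mathcal{S})$, with $\mathcal{P}_1$ and $\mathcal{W}=\mathcal{W}^1\times\dots\times\mathcal{W}^r$ nonempty and compact. Then for all $\pi\in\Pi_{\mathsf S}$ and $V\in\mathbb{R}^{\mathcal{S}}$, $$\bigcap_{s\in\mathcal{S}}\arg\min_{P\in\mathcal{P}}\langle P_s,\pi_sV^\top\rangle\neq\emptyset .$$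
   Context: $\mathcal{S}$ (states) and $\mathcal{A}$ (actions) are finite nonempty sets; $\Delta(E)$ denotes the set of probability distributions on a finite set $E$; $[r]=\{1,\dots,r\}$. Elements of $\mathcal{P}$ are written $P=(P_{sa})_{(s,a)}$ with $P_{sa}\in\Delta(\mathcal{S})\subset\mathbb{R}^{\mathcal{S}}$, and $P_s=(P_{sa})_{a\in\mathcal{A}}\in\mathbb{R}^{\mathcal{A}\times\mathcal{S}}$. $\Pi_{\mathsf S}=\Delta(\mathcal{A})^{\mathcal{S}}$, $\pi_s=(\pi_{sa})_a$. $\pi_sV^\top$ is the matrix with entries $\pi_{sa}V_{s'}$ and $\langle A,B\rangle=\sum_{i,j}A_{ij}B_{ij}$, so $\langle P_s,\pi_sV^\top\rangle=\sum_a\pi_{sa}P_{sa}^\top V$. An empty part of the partition contributes a trivial one-point factor to the product $\mathcal{P}_1\times\mathcal{P}_2$. *)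

(* Defs.v *)
From HB Require Import structures.
From mathcomp Require Import all_boot all_order all_algebra.
From mathcomp Require Import all_classical all_reals all_analysis.

Set Implicit Arguments.
Unset Strict Implicit.
Unset Printing Implicit Defensive.

Import Order.TTheory GRing.Theory Num.Theory.
Import numFieldNormedType.Exports.

Local Open Scope classical_set_scope.
Local Open Scope ring_scope.

Section Generic.
Variable R : realType.

Definition simplex (E : finType) : set (E -> R) :=
  [set p | (forall e, 0 <= p e) /\ \sum_e p e = 1].

Definition argmin (T : Type) (D : set T) (f : T -> R) : set T :=
  [set x | D x /\ forall y, D y -> f x <= f y].

(* When I is empty this is the one-point set of all functions from I. *)
Definition set_prod (I T : Type) (X : I -> set T) : set (I -> T) :=
  [set f | forall i, X i (f i)].

Definition outer (I J : Type) (x : I -> R) (y : J -> R) : I -> J -> R :=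
  fun i j => x i * y j.

Definition inner (I J : finType) (M N : I -> J -> R) : R :=
  \sum_i \sum_j M i j * N i j.

End Generic.

Definition subtype_restrict (S : finType) (T : Type) (X : {set S})
    (f : S -> T) : {s : S | s \in X} -> T := fun s => f (val s).

(* For a partition X, Y of S, T^S is identified with T^X * T^Y through the two
   restriction maps. *)
Definition part_prod (S : finType) (T : Type) (X Y : {set S})
    (F : set ({s : S | s \in X} -> T)) (G : set ({s : S | s \in Y} -> T)) :
  set (S -> T) :=
  [set f | F (subtype_restrict f) /\ G (subtype_restrict f)].

Section Kernels.
Variables (R : realType) (S A : finType).

Definition mixture (r : nat) (Y : {set S})
    (u : {s : S | s \in Y} -> A -> 'I_r -> R) (w : 'I_r -> S -> R) :
  {s : S | s \in Y} -> A -> S -> R :=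
  fun s a s' => \sum_(i < r) u s a i * w i s'.

Definition mixture_set (r : nat) (Y : {set S})
    (u : {s : S | s \in Y} -> A -> 'I_r -> R) (W : 'I_r -> set (S -> R)) :
  set ({s : S | s \in Y} -> A -> S -> R) :=
  mixture u @` set_prod W.

End Kernels.

(* Main.v *)
Require Import Defs.
From HB Require Import structures.
From mathcomp Require Import all_boot all_order all_algebra.
From mathcomp Require Import all_classical all_reals all_analysis.

From mathcomp Require Import ring.

Set Implicit Arguments.
Unset Strict Implicit.
Unset Printing Implicit Defensive.

Import Order.TTheory GRing.Theory Num.Theory.
Import numFieldNormedType.Exports.

Local Open Scope classical_set_scope.
Local Open Scope ring_scope.

(** The objective at a state is linear in the kernel, so its minimisation
    decouples along any product.  On [S1] the kernels of different states are
    chosen independently, hence each state can be given its own minimiser.  On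
    [S2] all states share the factors [w]; however, the objective at [s] is
    [\sum_i c s i * \sum_s' w i s' * V s'], where
    [c s i = \sum_a pi s a * u s a i] is nonnegative ([inner_mixture]).  Hence
    a [w] in which every [w i] minimises the linear functional given by [V]
    over [W i] is optimal at all states of [S2] at once.

    Both minimisers come from [set_prod_argmin], and [partition_glue] assembles
    the two halves into one kernel. *)

(** A cost that reads only coordinate [i] of [x] attains its minimum over the
    compact product, by the extreme value theorem.  The [i]-th coordinate of a
    minimiser is optimal in the whole factor [X i], because overwriting that
    coordinate by any [y] of [X i] stays inside the product.  Working with the
    product avoids having to show that the factors are compact. *)
Lemma set_prod_argmin (R : realType) (I : choiceType) (T : topologicalType)
    (X : I -> set T) (f : I -> T -> R) :
  set_prod X !=set0 -> compact (set_prod X : set {ptws I -> T}) ->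
  (forall i, continuous (f i)) ->
  exists x, forall i, argmin (X i) (f i) (x i).
Proof.
move=> X0 Xc fc.
suff coord i : exists xi, argmin (X i) (f i) xi.
  by have [x xP] := choice coord; exists x.
have fic : continuous (fun x : {ptws I -> T} => f i (x i)).
  move=> x.
  apply: (@continuous_comp _ _ _ (fun y : {ptws I -> T} => y i) (f i)).
    exact: (@proj_continuous I (fun=> T) i x).
  exact: fc.
have [x /set_mem Xx xmin] :=
  @compact_EVT_min {ptws I -> T} R _ _ X0 Xc (continuous_subspaceT fic).
exists (x i); split; first exact: Xx.
move=> y Xy.
have /mem_set/xmin : set_prod X (dfwith x i y).
  by move=> j; case: dfwithP.
by rewrite dfwithin.
Qed.

Lemma continuous_pairing (R : realType) (T : topologicalType) (J : finType)
    (g : J -> T -> R) (c : J -> R) :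
  (forall j, continuous (g j)) -> continuous (fun x => \sum_j g j x * c j).
Proof.
move=> gc; apply: continuous_big; first by move=> x; exact: add_continuous.
by move=> j _ x; apply: cvgM; [exact: gc|exact: cvg_cst].
Qed.

Lemma ptws_eval_continuous (J : choiceType) (T : topologicalType) (j : J) :
  continuous (fun x : {ptws J -> T} => x j).
Proof. exact: (@proj_continuous J (fun=> T) j). Qed.

Lemma inner_continuous (R : realType) (I J : finType) (N : I -> J -> R) :
  continuous (fun M : {ptws I -> {ptws J -> R}} => inner M N).
Proof.
apply: continuous_big; first by move=> x; exact: add_continuous.
move=> i _; apply: continuous_pairing => j M.
apply: (@continuous_comp _ _ _
  (fun y : {ptws I -> {ptws J -> R}} => y i) (fun z : {ptws J -> R} => z j)).
  exact: ptws_eval_continuous.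
exact: ptws_eval_continuous.
Qed.

(** Exchanging the sums writes the objective of a mixed kernel as a combination
    of the linear costs of the factors [w i].  The weights depend on the state
    and the policy, but the costs to be weighted do not: this is why one choice
    of [w] can be optimal for every state. *)
Lemma inner_mixture (R : realType) (S A : finType) (r : nat) (Y : {set S})
    (u : {s : S | s \in Y} -> A -> 'I_r -> R) (w : 'I_r -> S -> R) s
    (p : A -> R) (V : S -> R) :
  inner (mixture u w s) (outer p V) =
  \sum_i (\sum_a p a * u s a i) * \sum_s' w i s' * V s'.
Proof.
transitivity
  (\sum_a \sum_i p a * u s a i * \sum_s' w i s' * V s'); last first.
  by rewrite exchange_big; apply: eq_bigr => i _; rewrite mulr_suml.
apply: eq_bigr => a _.
transitivity (\sum_s' \sum_i p a * u s a i * (w i s' * V s')).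
  apply: eq_bigr => s' _; rewrite mulr_suml; apply: eq_bigr => i _.
  by rewrite /outer; ring.
by rewrite exchange_big; apply: eq_bigr => i _; rewrite mulr_sumr.
Qed.

(** Surjectivity half of the identification of [T^S] with [T^X * T^Y].  The
    covering hypothesis provides a value at each point, so that [T] may be any
    type, without a default element. *)
Lemma partition_glue (S : finType) (T : Type) (X Y : {set S})
    (f : {s : S | s \in X} -> T) (g : {s : S | s \in Y} -> T) :
  (X :|: Y = [set: S])%SET -> [disjoint X & Y]%B ->
  exists h : S -> T, subtype_restrict h = f /\ subtype_restrict h = g.
Proof.
move=> XYT XY0.
have /choice[h hP] s : exists t : T,
    (forall sX : s \in X, t = f (exist _ s sX)) /\
    (forall sY : s \in Y, t = g (exist _ s sY)).
  have : s \in (X :|: Y)%SET by rewrite XYT inE.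
  case/setUP => sZ.
    exists (f (exist _ s sZ)); split=> [sX|sY].
      by rewrite (bool_irrelevance sX sZ).
    by have := disjointFr XY0 sZ; rewrite sY.
  exists (g (exist _ s sZ)); split=> [sX|sY].
    by have := disjointFl XY0 sZ; rewrite sX.
  by rewrite (bool_irrelevance sY sZ).
by exists h; split; apply/funext => -[s sZ]; [apply: (hP s).1|apply: (hP s).2].
Qed.

Theorem proposition5 (R : realType) (S A : finType)
  (S_nonempty : (0 < #|S|)%N) (A_nonempty : (0 < #|A|)%N)
  (S1 S2 : {set S})
  (S12_cover : (S1 :|: S2 = [set: S])%SET) (S12_disjoint : [disjoint S1 & S2]%B)
  (Ps : {s : S | s \in S1} -> set (A -> S -> R))
  (Ps_sub : forall s, Ps s `<=` set_prod (fun _ : A => @simplex R S))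
  (r : nat)
  (u : {s : S | s \in S2} -> A -> 'I_r -> R)
  (u_simplex : forall s a, simplex (u s a))
  (W : 'I_r -> set (S -> R))
  (W_sub : forall i, W i `<=` @simplex R S)
  (P1_nonempty : set_prod Ps !=set0)
  (P1_compact : compact
     (set_prod Ps : set {ptws {s : S | s \in S1} -> {ptws A -> {ptws S -> R}}}))
  (W_nonempty : set_prod W !=set0)
  (W_compact : compact (set_prod W : set {ptws 'I_r -> {ptws S -> R}}))
  (pi : S -> A -> R) (pi_policy : forall s, simplex (pi s))
  (V : S -> R) :
  \bigcap_(s in [set: S])
    argmin (part_prod (set_prod Ps) (mixture_set u W))
      (fun P : S -> A -> S -> R => inner (P s) (outer (pi s) V)) !=set0.
Proof.
have [P1 P1min] : exists P1, forall s,
    argmin (Ps s) (fun M => inner M (outer (pi (val s)) V)) (P1 s).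
  apply: (@set_prod_argmin R _ {ptws A -> {ptws S -> R}}) => // s.
  exact: inner_continuous.
have [w wmin] : exists w, forall i,
    argmin (W i) (fun v => \sum_s v s * V s) (w i).
  apply: (@set_prod_argmin R _ {ptws S -> R}) => // i.
  by apply: continuous_pairing => s; exact: ptws_eval_continuous.
have [P [PP1 Pw]] := partition_glue P1 (mixture u w) S12_cover S12_disjoint.
exists P => s _; split.
  split; first by rewrite PP1 => t; case: (P1min t).
  by rewrite Pw; exists w => // i; case: (wmin i).
move=> Q [Q1 [v Wv Qv]].
have : s \in (S1 :|: S2)%SET by rewrite S12_cover inE.
case/setUP => sS.
  pose t : {s : S | s \in S1} := exist _ s sS.
  have -> : P s = P1 t by rewrite -PP1.
  exact: (P1min t).2 _ (Q1 t).
pose t : {s : S | s \in S2} := exist _ s sS.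
have -> : P s = mixture u w t by rewrite -Pw.
have -> : Q s = mixture u v t by rewrite Qv.
(* Termwise comparison, legitimate because the weights are nonnegative. *)
rewrite !inner_mixture; apply: ler_sum => i _; apply: ler_wpM2l.
  apply: sumr_ge0 => a _; apply: mulr_ge0; first exact: (pi_policy s).1.
  exact: (u_simplex t a).1.
exact: (wmin i).2.
Qed.
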